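(* Let $\mathrm{T}$ be a first-order theory, $\vdash$ a provability relation, and $S$ a set of closed terms. Assume that for every atomic formula $\varphi$, and every sentence $\bar\varphi$ obtained from $\varphi$ by substituting terms from $S$ for all of its free variables, we have $\mathrm{T}\vdash\bar\varphi$ or $\mathrm{T}\vdash\neg\bar\varphi$. Then for every sentence $\sigma$, $\mathrm{T}\vdash_S\sigma$ or $\mathrm{T}\vdash_S\neg\sigma$; i.e., the theory $[\mathrm{T},\vdash_S]$ is complete.
   Context: We work in first-order finitary logic $\mathscr L_{\omega,\omega}$ over a fixed vocabulary $\tau$. A provability relation $\vdash$ means the provability generated by the standard axioms and rules of classical first-order logic, or any stronger provability relation. For a set $S$ of closed terms of $\tau$, the $S$-rule is the schema of rules which, for each formula $\varphi$ with a single free variable $x$, infers $\forall x\,\varphi(x)$ from the set of premises $\{\varphi(t): t\in S\}$; $\vdash_S$ denotes the provability generated by $\vdash$ together with the $S$-rule. $[\mathrm{T},\vdash]$ denotes $\{\varphi:\mathrm{T}\vdash\varphi\}$; a theory is complete if for every sentence it contains the sentence or its negation. *)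

(* Defs.v *)
From mathcomp Require Import ssreflect ssrfun ssrbool eqtype ssrnat fintype.
From mathcomp Require Import classical_sets.

Set Implicit Arguments.
Unset Strict Implicit.
Unset Printing Implicit Defensive.

Local Open Scope classical_set_scope.

Record vocabulary := Vocabulary {
  fsym : Type;
  farity : fsym -> nat;
  rsym : Type;
  rarity : rsym -> nat
}.

(* Variables are the natural numbers; constants are the function symbols of
   arity 0. *)
Inductive term (tau : vocabulary) : Type :=
| Var of nat
| Fun (f : fsym tau) of ('I_(farity f) -> term tau).

Arguments Var {tau} _.
Arguments Fun {tau} f _.

(* Equality is a logical symbol; conjunction, disjunction and the existential
   quantifier are the usual abbreviations. *)
Inductive formula (tau : vocabulary) : Type :=
| Eq of term tau & term tau
| Rel (r : rsym tau) of ('I_(rarity r) -> term tau)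
| Not of formula tau
| Imp of formula tau & formula tau
| All of nat & formula tau.

Arguments Rel {tau} r _.

Section Syntax.
Variable tau : vocabulary.
Implicit Types (t s : term tau) (phi psi chi : formula tau) (x y : nat).

Fixpoint occurs x t : Prop :=
  match t with
  | Var y => y = x
  | Fun f a => exists i, occurs x (a i)
  end.

Fixpoint free x phi : Prop :=
  match phi with
  | Eq s t => occurs x s \/ occurs x t
  | Rel r a => exists i, occurs x (a i)
  | Not psi => free x psi
  | Imp psi chi => free x psi \/ free x chi
  | All y psi => y <> x /\ free x psi
  end.

Definition closed_term t : Prop := forall x, ~ occurs x t.

Definition sentence phi : Prop := forall x, ~ free x phi.

Definition atomic phi : Prop :=
  match phi with
  | Eq _ _ | Rel _ _ => True
  | _ => False
  end.

Definition update (e : nat -> term tau) x t : nat -> term tau :=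
  fun y => if y == x then t else e y.

Fixpoint tsubst (e : nat -> term tau) t : term tau :=
  match t with
  | Var x => e x
  | Fun f a => Fun f (fun i => tsubst e (a i))
  end.

(* Simultaneous replacement of the free occurrences of each x by e x. Bound
   variables are not renamed: for the terms that are not closed, capture is
   excluded by [substitutable] below. *)
Fixpoint subst (e : nat -> term tau) phi : formula tau :=
  match phi with
  | Eq s t => Eq (tsubst e s) (tsubst e t)
  | Rel r a => Rel r (fun i => tsubst e (a i))
  | Not psi => Not (subst e psi)
  | Imp psi chi => Imp (subst e psi) (subst e chi)
  | All x psi => All x (subst (update e x (Var x)) psi)
  end.

Definition subst1 x t phi : formula tau := subst (update Var x t) phi.

Fixpoint substitutable t x phi : Prop :=
  match phi with
  | Eq _ _ | Rel _ _ => True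
  | Not psi => substitutable t x psi
  | Imp psi chi => substitutable t x psi /\ substitutable t x chi
  | All y psi =>
      ~ free x (All y psi) \/ (~ occurs y t /\ substitutable t x psi)
  end.

(* Classical first-order logic with equality, in the presentation where the
   axioms are closed under universal generalization and modus ponens is the
   only rule. From a set of sentences it proves the same formulas as the
   presentations with a generalization rule; from open hypotheses it proves
   less, so that more relations extend it. *)
Inductive fo_axiom : formula tau -> Prop :=
| ax_K phi psi : fo_axiom (Imp phi (Imp psi phi))
| ax_S phi psi chi :
    fo_axiom (Imp (Imp phi (Imp psi chi)) (Imp (Imp phi psi) (Imp phi chi)))
| ax_contra phi psi :
    fo_axiom (Imp (Imp (Not phi) (Not psi)) (Imp psi phi))
| ax_inst x t phi :
    substitutable t x phi -> fo_axiom (Imp (All x phi) (subst1 x t phi))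
| ax_dist x phi psi :
    fo_axiom (Imp (All x (Imp phi psi)) (Imp (All x phi) (All x psi)))
| ax_vacuous x phi : ~ free x phi -> fo_axiom (Imp phi (All x phi))
| ax_refl t : fo_axiom (Eq t t)
| ax_leibniz x s t phi :
    substitutable s x phi -> substitutable t x phi ->
    fo_axiom (Imp (Eq s t) (Imp (subst1 x s phi) (subst1 x t phi)))
| ax_gen x phi : fo_axiom phi -> fo_axiom (All x phi).

(* [R Delta phi]: the possibly infinite set of premises Delta and the
   conclusion phi form an instance of the rules R; axioms are rules without
   premises. *)
Inductive generated (R : set (formula tau) -> formula tau -> Prop)
    (Gamma : set (formula tau)) : formula tau -> Prop :=
| gen_hyp phi : Gamma phi -> generated R Gamma phi
| gen_rule Delta phi :
    R Delta phi -> (forall psi, Delta psi -> generated R Gamma psi) ->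
    generated R Gamma phi.

Inductive fo_rule : set (formula tau) -> formula tau -> Prop :=
| fo_ax phi : fo_axiom phi -> fo_rule set0 phi
| fo_mp phi psi : fo_rule [set phi; Imp phi psi] psi.

Definition fo_provability := generated fo_rule.

(* A consequence relation at least as strong as first-order provability;
   reflexivity and monotonicity follow from the two clauses. The relation need
   not be finitary. *)
Record provability (prov : set (formula tau) -> formula tau -> Prop) : Prop :=
  Provability {
    prov_fo : forall Gamma phi, fo_provability Gamma phi -> prov Gamma phi;
    prov_cut : forall Gamma Delta phi,
      (forall psi, Delta psi -> prov Gamma psi) -> prov Delta phi ->
      prov Gamma phi
  }.

Inductive S_rule (S : set (term tau)) :
    set (formula tau) -> formula tau -> Prop :=
| S_rule_intro x phi : (forall y, free y phi <-> y = x) ->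
    S_rule S [set subst1 x t phi | t in S] (All x phi).

Definition prov_S (prov : set (formula tau) -> formula tau -> Prop)
    (S : set (term tau)) : set (formula tau) -> formula tau -> Prop :=
  generated (fun Delta phi => prov Delta phi \/ S_rule S Delta phi).

Definition theory_of (prov : set (formula tau) -> formula tau -> Prop)
    (T : set (formula tau)) : set (formula tau) :=
  [set phi | prov T phi].

Definition complete (T : set (formula tau)) : Prop :=
  forall sigma, sentence sigma -> T sigma \/ T (Not sigma).

End Syntax.

(* Main.v *)
(** By induction on phi, every instance of phi under an assignment of terms of
    S to its free variables is decided by T under the S-rule. In the quantifier
    case either all S-instances of the body are provable and the S-rule yields
    the universal formula, or one of them is refutable and instantiation
    refutes it. *)

Require Import Defs.
From mathcomp Require Import ssreflect ssrfun ssrbool eqtype ssrnat fintype.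
From mathcomp Require Import boolp classical_sets.

Set Implicit Arguments.
Unset Strict Implicit.
Unset Printing Implicit Defensive.

Local Open Scope classical_set_scope.

(** * Simultaneous substitution: composition, free variables and capture *)

Section Substitution.
Variable tau : vocabulary.
Implicit Types (t : term tau) (phi psi : formula tau) (x y : nat).
Implicit Types e : nat -> term tau.

Lemma update_eq e x t : update e x t x = t.
Proof. by rewrite /update eqxx. Qed.

Lemma update_neq e x t y : y <> x -> update e x t y = e y.
Proof. by rewrite /update => /eqP/negbTE ->. Qed.

Lemma update_Var x : update Var x (Var x) = Var :> (nat -> term tau).
Proof. by apply: funext => y; rewrite /update; case: eqP => [->|]. Qed.

Lemma tsubst_eq e e' t :
  (forall x, occurs x t -> e x = e' x) -> tsubst e t = tsubst e' t.
Proof.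
elim: t => [x|f a IH] /= H; first exact: H.
by congr Fun; apply: funext => i; apply: IH => x xi; apply: H; exists i.
Qed.

Lemma tsubst_Var t : tsubst Var t = t.
Proof. by elim: t => [//|f a IH] /=; congr Fun; apply: funext. Qed.

Lemma tsubst_comp e e' t :
  tsubst e' (tsubst e t) = tsubst (fun x => tsubst e' (e x)) t.
Proof. by elim: t => [//|f a IH] /=; congr Fun; apply: funext. Qed.

Lemma occurs_tsubst e t y :
  occurs y (tsubst e t) <-> exists2 z, occurs z t & occurs y (e z).
Proof.
elim: t => [x|f a IH] /=; first by split=> [|[z <-]] //; exists x.
split=> [[i /IH[z zi yz]]|[z [i zi] yz]]; first by exists z => //; exists i.
by exists i; apply/IH; exists z.
Qed.

Lemma subst_eq e e' phi :
  (forall x, free x phi -> e x = e' x) -> subst e phi = subst e' phi.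
Proof.
elim: phi e e' => [s t|r a|psi IH|psi IHpsi chi IHchi|y psi IH] e e' /= H.
- by congr Eq; apply: tsubst_eq => x xt; apply: H; [left|right].
- congr Rel; apply: funext => i; apply: tsubst_eq => x xt.
  by apply: H; exists i.
- by congr Not; apply: IH.
- by congr Imp; [apply: IHpsi|apply: IHchi] => x xf; apply: H; [left|right].
- congr All; apply: IH => x xf; rewrite /update; case: eqP => // xy.
  by apply: H; split=> // yx; apply: xy.
Qed.

Lemma subst_Var phi : subst Var phi = phi.
Proof.
elim: phi => [s t|r a|psi IH|psi IHpsi chi IHchi|y psi IH] /=.
- by rewrite !tsubst_Var.
- by congr Rel; apply: funext => i; exact: tsubst_Var.
- by rewrite IH.
- by rewrite IHpsi IHchi.
- by rewrite update_Var IH.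
Qed.

(* Substitutions of this kind cannot capture variables. *)
Definition partly_closing e (A : nat -> Prop) : Prop :=
  forall y, A y -> e y = Var y \/ closed_term (e y).

(** Lets inductions on formulas pass under a quantifier: the newly exposed variable [x] is sent to
    itself, and every other free variable was already free outside. *)
Lemma partly_closing_update e x psi :
  partly_closing e (fun z => free z (All x psi)) ->
  partly_closing (update e x (Var x)) (fun z => free z psi).
Proof.
move=> H y yf; rewrite /update; case: eqP => [->|yx]; first by left.
by apply: H; split=> // xy; apply: yx.
Qed.

(** For arbitrary [e] this can fail: a variable that [e] brings under a quantifier binding it is
    shielded from [e']. *)
Lemma subst_comp e e' phi : partly_closing e (fun z => free z phi) ->
  subst e' (subst e phi) = subst (fun x => tsubst e' (e x)) phi.
Proof.
elim: phi e e' => [s t|r a|psi IH|psi IHpsi chi IHchi|x psi IH] e e' /= H.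
- by rewrite !tsubst_comp.
- by congr Rel; apply: funext => i; exact: tsubst_comp.
- by rewrite IH.
- by rewrite IHpsi ?IHchi // => y yf; apply: H; [right|left].
- rewrite IH; last exact: partly_closing_update.
  congr All; apply: subst_eq => y yf.
  have [->|yx] := eqVneq y x; first by rewrite !update_eq /= update_eq.
  move/eqP: yx => yx; rewrite !(update_neq _ _ yx).
  (* A fixed [y] differs from [x], so the update at [x] does not affect it; a closed [e y] is
     unaffected by any substitution. *)
  have [|->|cl] := H y; first by split=> // xy; apply: yx.
    by rewrite /= update_neq.
  by apply: tsubst_eq => z /cl.
Qed.

Lemma occurs_partly_closing e t y : partly_closing e (fun z => occurs z t) ->
  occurs y (tsubst e t) <-> occurs y t /\ e y = Var y.
Proof.
move=> H; rewrite occurs_tsubst; split=> [[z zt yz]|[yt ey]].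
  case: (H z zt) => [ez|/(_ y)//]; move: yz; rewrite ez /= => zy.
  by rewrite -zy.
by exists y => //; rewrite ey.
Qed.

(** Closed values contribute no variables, so only fixed variables survive. This serves to check the
    side condition of the S-rule. *)
Lemma free_subst e phi y : partly_closing e (fun z => free z phi) ->
  free y (subst e phi) <-> free y phi /\ e y = Var y.
Proof.
elim: phi e => [s t|r a|psi IH|psi IHpsi chi IHchi|x psi IH] e /= H.
- have Hs : partly_closing e (fun z => occurs z s).
    by move=> z zs; apply: H; left.
  have Ht : partly_closing e (fun z => occurs z t).
    by move=> z zt; apply: H; right.
  rewrite !occurs_partly_closing //; tauto.
- have Ha i : partly_closing e (fun z => occurs z (a i)).
    by move=> z zi; apply: H; exists i.
  split=> [[i /(occurs_partly_closing _ (Ha i))[yi ey]]|[[i yi] ey]].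
    by split=> //; exists i.
  by exists i; apply/(occurs_partly_closing _ (Ha i)).
- exact: IH.
- have Hpsi : partly_closing e (fun z => free z psi).
    by move=> z zf; apply: H; left.
  have Hchi : partly_closing e (fun z => free z chi).
    by move=> z zf; apply: H; right.
  rewrite IHpsi // IHchi //; tauto.
- rewrite IH; last exact: partly_closing_update.
  by split=> [[xy [yf ey]]|[[xy yf] ey]]; split=> //;
    move: ey; rewrite update_neq // => yx; apply: xy.
Qed.

Lemma closed_substitutable t x phi : closed_term t -> substitutable t x phi.
Proof.
move=> cl; elim: phi => //= y psi IH; right; split=> //; exact: cl.
Qed.

Lemma nfree_substitutable t x phi : ~ free x phi -> substitutable t x phi.
Proof.
elim: phi => //= [psi IHpsi chi IHchi xf|y psi _ xf]; last by left.
by split; [apply: IHpsi|apply: IHchi] => xf'; apply: xf; [left|right].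
Qed.

End Substitution.

(** * Propositional derivations in any set closed under the axioms and modus ponens *)

Section Propositional.
Variables (tau : vocabulary) (P : formula tau -> Prop).
Hypothesis P_ax : forall phi, fo_axiom phi -> P phi.
Hypothesis P_mp : forall phi psi, P phi -> P (Imp phi psi) -> P psi.
Implicit Types phi psi chi : formula tau.

Lemma imp_weaken phi psi : P psi -> P (Imp phi psi).
Proof. by move=> H; apply: P_mp H _; apply: P_ax; constructor. Qed.

Lemma imp_app phi psi chi :
  P (Imp phi (Imp psi chi)) -> P (Imp phi psi) -> P (Imp phi chi).
Proof.
by move=> H1 H2; apply: P_mp H2 _; apply: P_mp H1 _; apply: P_ax; constructor.
Qed.

Lemma imp_trans phi psi chi :
  P (Imp phi psi) -> P (Imp psi chi) -> P (Imp phi chi).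
Proof. by move=> H1 H2; apply: imp_app H1; exact: imp_weaken. Qed.

Lemma imp_id phi : P (Imp phi phi).
Proof. by apply: (@imp_app _ (Imp phi phi)); apply: P_ax; constructor. Qed.

Lemma imp_efq phi psi : P (Not phi) -> P (Imp phi psi).
Proof.
move=> H; apply: P_mp (P_ax (ax_contra _ _)).
exact: imp_weaken.
Qed.

(** Two contrapositions below the premise turn the instance of [ax_K] with conclusion [Imp (Not (Not
    (Not (Not phi)))) (Not (Not phi))] into one with conclusion [Imp (Not (Not phi)) phi]; the
    repeated premise is then contracted. *)
Lemma imp_dne phi : P (Imp (Not (Not phi)) phi).
Proof.
apply: imp_app (imp_id _).
apply: imp_trans (P_ax (ax_contra _ _)).
apply: imp_trans (P_ax (ax_contra _ _)).
exact: P_ax (ax_K _ _).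
Qed.

Lemma imp_dni phi : P (Imp phi (Not (Not phi))).
Proof. exact: P_mp (imp_dne _) (P_ax (ax_contra _ _)). Qed.

Lemma modus_tollens phi psi : P (Imp phi psi) -> P (Not psi) -> P (Not phi).
Proof.
move=> H Hn; apply: P_mp Hn _; apply: P_mp (P_ax (ax_contra _ _)).
apply: imp_trans (imp_dne _) _.
exact: imp_trans H (imp_dni _).
Qed.

(** Given [phi], the formula [Imp (Imp phi psi) psi] is derivable, and its contraposition applies to
    [Not psi]. *)
Lemma not_imp phi psi : P phi -> P (Not psi) -> P (Not (Imp phi psi)).
Proof.
move=> H; apply: modus_tollens.
by apply: imp_app (imp_id _) _; exact: imp_weaken.
Qed.

End Propositional.

(** * Deciding the instances of formulas over [S] *)

Section Decision.
Variables (tau : vocabulary) (T : set (formula tau)).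
Variable prov : set (formula tau) -> formula tau -> Prop.
Variable S : set (term tau).
Hypothesis Hprov : provability prov.
Hypothesis HS : forall t : term tau, S t -> closed_term t.
Implicit Types (phi psi : formula tau) (e : nat -> term tau).

(** All of [T] serves as the premise set of one rule instance, so [prov] may be infinitary. *)
Lemma prov_S_prov phi : prov T phi -> prov_S prov S T phi.
Proof.
by move=> H; apply: (@gen_rule _ _ _ T); [left|move=> psi; exact: gen_hyp].
Qed.

Lemma prov_S_ax phi : fo_axiom phi -> prov_S prov S T phi.
Proof.
move=> H; apply/prov_S_prov/(prov_fo Hprov).
by apply: (@gen_rule _ _ _ set0) => //; exact: fo_ax.
Qed.

Lemma prov_S_mp phi psi :
  prov_S prov S T phi -> prov_S prov S T (Imp phi psi) -> prov_S prov S T psi.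
Proof.
move=> H1 H2; apply: (@gen_rule _ _ _ [set phi; Imp phi psi]).
  left; apply: (prov_fo Hprov).
  by apply: gen_rule (fo_mp _ _) _ => chi; exact: gen_hyp.
by move=> chi [] ->.
Qed.

Definition decided phi := prov_S prov S T phi \/ prov_S prov S T (Not phi).

Lemma decided_not phi : decided phi -> decided (Not phi).
Proof.
case=> H; [right|by left].
exact: prov_S_mp H (imp_dni prov_S_ax prov_S_mp _).
Qed.

Lemma decided_imp phi psi : decided phi -> decided psi -> decided (Imp phi psi).
Proof.
move=> [Hphi|Hphi]; last by left; exact: imp_efq prov_S_ax prov_S_mp _ _ Hphi.
move=> [Hpsi|Hpsi].
  by left; exact: imp_weaken prov_S_ax prov_S_mp _ _ Hpsi.
by right; exact: not_imp prov_S_ax prov_S_mp _ _ Hphi Hpsi.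
Qed.

Lemma refute_all x t phi : substitutable t x phi ->
  prov_S prov S T (Not (subst1 x t phi)) -> prov_S prov S T (Not (All x phi)).
Proof.
move=> sub; apply: (modus_tollens prov_S_ax prov_S_mp).
exact: prov_S_ax (ax_inst sub).
Qed.

(** The S-rule asks that [x] be free in the body, so a vacuous quantifier is treated apart.
    Refutation instantiates at [Var x], which works even when [S] is empty. *)
Lemma decided_all_vacuous x phi :
  ~ free x phi -> decided phi -> decided (All x phi).
Proof.
move=> xf [H|H]; [left|right].
  exact: prov_S_mp H (prov_S_ax (ax_vacuous xf)).
apply: (@refute_all x (Var x)); first exact: nfree_substitutable.
by rewrite /subst1 update_Var subst_Var.
Qed.

Lemma decided_all x phi : (forall y, free y phi <-> y = x) ->
  (forall t, S t -> decided (subst1 x t phi)) -> decided (All x phi).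
Proof.
move=> xf H.
have [[t St Ht]|noref] :=
    pselect (exists2 t, S t & prov_S prov S T (Not (subst1 x t phi))).
  by right; apply: refute_all Ht; apply: closed_substitutable; exact: HS.
left; apply: gen_rule; first by right; exact: S_rule_intro xf.
by move=> _ [t St <-]; case: (H t St) => // Ht; case: noref; exists t.
Qed.

Hypothesis Hatomic : forall phi, atomic phi ->
  forall e, (forall x, free x phi -> S (e x)) ->
  prov T (subst e phi) \/ prov T (Not (subst e phi)).

Lemma decided_atomic phi e : atomic phi ->
  (forall x, free x phi -> S (e x)) -> decided (subst e phi).
Proof.
move=> a H.
by case: (Hatomic a H) => /prov_S_prov; [left|right].
Qed.

(** Quantification over all [e] is what the induction needs: the quantifier case uses the hypothesis
    on the body at [update e x t] for every [t] in [S]. *)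
Lemma decided_subst phi e :
  (forall x, free x phi -> S (e x)) -> decided (subst e phi).
Proof.
elim: phi e => [s t|r a|psi IH|psi IHpsi chi IHchi|x psi IH] e H.
- exact: decided_atomic.
- exact: decided_atomic.
- by apply: decided_not; exact: IH.
- by apply: decided_imp; [apply: IHpsi|apply: IHchi] => y yf; apply: H;
    [left|right].
have Sfree y : free y psi -> y <> x -> S (e y).
  by move=> yf yx; apply: H; split=> // xy; apply: yx.
have pc : partly_closing (update e x (Var x)) (fun z => free z psi).
  by apply: partly_closing_update => y /H /HS; right.
rewrite /=; have [xf|xf] := pselect (free x psi); last first.
  apply: decided_all_vacuous; first by move/(free_subst _ pc) => [].
  (* The update sends [x] to a variable, but [x] is not free in [psi], so the induction hypothesis
     can be used at [e] itself. *)
  have -> : subst (update e x (Var x)) psi = subst e psi.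
    by apply: subst_eq => y yf; rewrite update_neq // => yx; rewrite yx in yf.
  by apply: IH => y yf; apply: Sfree => // yx; rewrite yx in yf.
apply: decided_all => [y|t St].
  rewrite free_subst //; split=> [[yf ey]|->]; last by rewrite update_eq.
  (* A surviving [y] other than [x] would make [Var y] the closed term [e y]. *)
  apply: contrapT => yx; move: ey; rewrite update_neq // => ey.
  by have := HS (Sfree _ yf yx) (x := y); rewrite ey; apply.
(* The two substitutions merge into one because each [e y] put in first is closed and hence
   untouched by replacing [x] with [t]. *)
have -> : subst1 x t (subst (update e x (Var x)) psi) =
    subst (update e x t) psi.
  rewrite /subst1 subst_comp //; apply: subst_eq => y yf.
  have [->|/eqP yx] := eqVneq y x; first by rewrite !update_eq /= update_eq.
  rewrite !(update_neq _ _ yx) -[RHS]tsubst_Var; apply: tsubst_eq => z ze.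
  by case: (HS (Sfree _ yf yx) ze).
by apply: IH => y yf; rewrite /update; case: eqP => // yx; exact: Sfree.
Qed.

End Decision.

Theorem theorem1 (tau : vocabulary)
    (T : set (formula tau))
    (prov : set (formula tau) -> formula tau -> Prop)
    (S : set (term tau))
    (Hprov : provability prov)
    (HS : forall t : term tau, S t -> closed_term t)
    (Hatomic : forall phi : formula tau, atomic phi ->
       forall e : nat -> term tau, (forall x : nat, free x phi -> S (e x)) ->
       prov T (subst e phi) \/ prov T (Not (subst e phi))) :
  complete (theory_of (prov_S prov S) T).
Proof.
(* A sentence is its own instance under [Var], and the condition on its free variables is
   vacuous. *)
move=> sigma closed_sigma; rewrite -(subst_Var sigma).
by apply: decided_subst => // x /closed_sigma.
Qed.
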